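(* In the setting of the context, there is a constant $j_*$ depending only on the geometric data such that for every supersymmetric configuration with $j_I\ge j_*$ for all $I=0,\dots,p$, every $\beta$-brane satisfies $$|m_0^\beta|\le \max_i T_i .$$ More precisely: special branes with $0\le C\big(\tfrac b2+\tfrac j{j_0},\,b+\tfrac{m^\beta}{m_0^\beta}\big)$ satisfy $|m_0^\beta|\le\max_iT_i$; special branes with $0\ge C\big(\tfrac b2+\tfrac j{j_0},\,b+\tfrac{m^\beta}{m_0^\beta}\big)$ satisfy $|m_0^\beta|\le 3$; and mixed branes satisfy $|m_0^\beta|\le3$.
   Context: Geometry. $B$ is a smooth projective complex surface, $\pi:X\to B$ is a smooth elliptically fibered Calabi--Yau threefold with a single section $\sigma$, so $\sigma^2=-c_1\sigma$ and $H^{1,1}(X)$ is spanned by $\sigma$ and $\pi^*H^{1,1}(B)$; $c_1,c_2$ are the Chern classes of $B$. Let $D_1,\dots,D_p\in H^2(B,\mathbb{Z})$, $p=h^{1,1}(B)\ge2$, be linearly independent classes generating the Kähler cone of $B$ or a simplicial subcone; their pullbacks to $X$ are denoted by the same symbols, and $D_0=\sigma+\pi^*c_1$. Let $C$ be the intersection form on $H^{1,1}(B)$, $C_{ij}=D_i\cdot D_j$. Write $c_1=\sum_i b_iD_i$, $b=(b_i)$, $\mathcal K_{00i}=\sum_j b_jC_{ij}$, $\mathcal K_{000}=\sum_{i,j} b_ib_jC_{ij}$. The triple intersection form $\mathcal K$ on $X$ is the symmetric trilinear form with $\mathcal K(D_i,D_j,D_k)=0$, $\mathcal K(D_0,D_i,D_j)=C_{ij}$,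 $\mathcal K(D_0,D_0,D_i)=\mathcal K_{00i}$, $\mathcal K(D_0,D_0,D_0)=\mathcal K_{000}$. Put $T_0=\int_B(c_2+11c_1^2)$ and $T_i=12\,\mathcal K_{00i}$. Assume: (1) all $D_i$ are time-like or light-like for $C$ ($C(D_i,D_i)\ge0$) and lie in the same closed light-cone; (2) $b_i\ge 0$ for all $i$; (3) every $\mathcal K_{00i}$ is a positive integer; (4) $C$ has signature $(1,p-1)$. Supersymmetric configuration: a finite collection of D9-brane stacks $\alpha$, each with a positive integer $N^\alpha$ and a flux $F^\alpha=m_0^\alpha D_0+\sum_{i}m_i^\alpha D_i\in H^2(X,\mathbb{Z})$ ($m_I^\alpha\in\mathbb{Q}$, $m_0^\alpha\in\mathbb{Z}$, $\sum_jC_{ij}m_j^\alpha\in\mathbb{Z}$), non-negative integers $n^{D5}_0,\dots,n^{D5}_p$, and a real Kähler class $J=j_0D_0+\sum_ij_iD_i$ with $j_I>0$, such that: $n^{D5}_I-T_I=\sum_\alpha N^\alpha\mathcal K(F^\alpha,F^\alpha,D_I)$ for $I=0,\dots,p$; $\sum_\alpha N^\alpha=16$; and for each $\alpha$, $3\mathcal K(J,J,F^\alpha)=\mathcal K(F^\alpha,F^\alpha,F^\alpha)$ and $\mathcal K(J,J,J)>3\mathcal K(J,F^\alpha,F^\alpha)$. Write $m^\alpha=(m_i^\alpha)_{i=1}^p$, $j=(j_i)_{i=1}^p$, viewed as vectors in $H^{1,1}(B)$ in the basis $D_i$. A $\beta$-brane is a stack with $m_0^\beta\ne0$. For it, $t_i^\beta=2\sum_jC_{ij}\big(\tfrac{b_j}2+\tfrac{m_j^\beta}{m_0^\beta}\big)$.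 A special brane is a $\beta$-brane with $t_i^\beta<0$ for all $i$; a mixed brane is a $\beta$-brane that is not special. *)

(* Defs.v *)
(* MathComp, over an arbitrary [R : realType]. *)
From mathcomp Require Import all_boot all_order all_algebra.
From mathcomp Require Import reals.

Set Implicit Arguments.
Unset Strict Implicit.
Unset Printing Implicit Defensive.

Import Order.TTheory GRing.Theory Num.Theory.
Local Open Scope ring_scope.

(* Sylvester's form of the signature of a nondegenerate symmetric matrix:
   congruent to diag(1, ..., 1, -1, ..., -1), with r entries 1 and s entries
   -1. *)
Definition has_signature (R : realType) (n : nat) (A : 'M[R]_n) (r s : nat) :
    Prop :=
  (r + s)%N = n /\
  exists2 P : 'M[R]_n, P \in unitmx &
    P^T *m A *m P = diag_mx (\row_(i < n) (if (i < r)%N then 1 else -1)).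

(* The numerical data of the base B of the elliptic fibration X -> B, in the
   basis D_1, ..., D_p of H^{1,1}(B); 'I_p numbers this basis from 0.
   [inter_mx] is the intersection matrix D_i . D_j, which is integral because the
   D_i lie in H^2(B, Z); [c1B] is the row b of coordinates of c_1(B), and [c2B]
   is the integral of c_2(B). *)
Record base_data (R : realType) (p : nat) := BaseData {
  inter_mx : 'M[int]_p;
  c1B : 'rV[R]_p;
  c2B : int
}.

Section Geometry.
Variables (R : realType) (p : nat) (G : base_data R p).

Definition Cmx : 'M[R]_p := map_mx intr (inter_mx G).

Definition Cform (u v : 'rV[R]_p) : R :=
  \sum_(i < p) \sum_(j < p) u 0 i * Cmx i j * v 0 j.

Definition K00 (i : 'I_p) : R := \sum_(j < p) c1B G 0 j * Cmx i j.

Definition K000 : R := \sum_(i < p) \sum_(j < p) c1B G 0 i * c1B G 0 j * Cmx i j.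

(* Classes on X are rows of coordinates in D_0, D_1, ..., D_p, indexed by
   'I_p.+1: [ord0] stands for D_0 = sigma + pi^* c_1, and [lift ord0 i] for the
   pullback of the basis element of H^{1,1}(B) with index i : 'I_p. *)
Definition Kcoef (I J L : 'I_p.+1) : R :=
  match unlift ord0 I, unlift ord0 J, unlift ord0 L with
  | None, None, None => K000
  | Some i, None, None | None, Some i, None | None, None, Some i => K00 i
  | Some i, Some j, None | Some i, None, Some j | None, Some i, Some j =>
      Cmx i j
  | Some _, Some _, Some _ => 0
  end.

Definition Kform (u v w : 'rV[R]_p.+1) : R :=
  \sum_(I < p.+1) \sum_(J < p.+1) \sum_(L < p.+1)
    Kcoef I J L * u 0 I * v 0 J * w 0 L.

Definition Dcls (I : 'I_p.+1) : 'rV[R]_p.+1 := delta_mx 0 I.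

Definition tadpole0 : R := (c2B G)%:~R + 11 * K000.

Definition tadpole_base (i : 'I_p) : R := 12 * K00 i.

Definition tadpole (I : 'I_p.+1) : R :=
  if unlift ord0 I is Some i then tadpole_base i else tadpole0.

(* The maximum runs over the base indices only, so T_0 is excluded.  The neutral
   element 0 is harmless: every K_{00i} is positive and p >= 2. *)
Definition max_tadpole : R := \big[Num.max/0]_(i < p) tadpole_base i.

(* A time-like [u] selects one of the two closed light-cones of C, namely the
   causal vectors pairing non-negatively with [u]. *)
Definition closed_light_cone (u v : 'rV[R]_p) : Prop :=
  0 <= Cform v v /\ 0 <= Cform u v.

Definition same_closed_light_cone (V : 'I_p -> 'rV[R]_p) : Prop :=
  exists u : 'rV[R]_p,
    0 < Cform u u /\ forall i : 'I_p, closed_light_cone u (V i).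

Record admissible_base : Prop := AdmissibleBase {
  inter_mx_sym : (inter_mx G)^T = inter_mx G;
  basis_causal : same_closed_light_cone (fun i => delta_mx 0 i);
  c1_ge0 : forall i : 'I_p, 0 <= c1B G 0 i;
  K00_int : forall i : 'I_p, K00 i \is a Num.int;
  K00_gt0 : forall i : 'I_p, 0 < K00 i;
  inter_signature : has_signature Cmx 1 p.-1
}.

End Geometry.

Section Branes.
Variables (R : realType) (p : nat) (G : base_data R p).

Definition m0 (F : 'rV[R]_p.+1) : R := F 0 ord0.

Definition base_part (F : 'rV[R]_p.+1) : 'rV[R]_p :=
  \row_(i < p) F 0 (lift ord0 i).

(* The conditions that F in H^2(X, Z) imposes on its coordinates. *)
Definition integral_flux (F : 'rV[R]_p.+1) : Prop :=
  [/\ forall I : 'I_p.+1, exists q : rat, F 0 I = ratr q,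
      m0 F \is a Num.int &
      forall i : 'I_p,
        \sum_(j < p) Cmx G i j * base_part F 0 j \is a Num.int].

Record configuration := Configuration {
  stacks : nat;
  nbranes : 'I_stacks -> nat;
  flux : 'I_stacks -> 'rV[R]_p.+1;
  nD5 : 'I_p.+1 -> nat;
  kahler : 'rV[R]_p.+1
}.

Record supersymmetric (S : configuration) : Prop := Supersymmetric {
  nbranes_gt0 : forall a : 'I_(stacks S), (0 < nbranes a)%N;
  flux_integral : forall a : 'I_(stacks S), integral_flux (flux a);
  kahler_gt0 : forall I : 'I_p.+1, 0 < kahler S 0 I;
  D5_tadpole : forall I : 'I_p.+1,
    (nD5 S I)%:R - tadpole G I =
    \sum_(a < stacks S) (nbranes a)%:R * Kform G (flux a) (flux a) (Dcls R I);
  D9_tadpole : (\sum_(a < stacks S) nbranes a = 16)%N;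
  susy_eq : forall a : 'I_(stacks S),
    3 * Kform G (kahler S) (kahler S) (flux a) =
    Kform G (flux a) (flux a) (flux a);
  susy_ineq : forall a : 'I_(stacks S),
    3 * Kform G (kahler S) (flux a) (flux a) <
    Kform G (kahler S) (kahler S) (kahler S)
}.

(* m^beta / m_0^beta for a flux, j / j_0 for the Kaehler class; junk when the
   0-th coordinate vanishes. *)
Definition slope (F : 'rV[R]_p.+1) : 'rV[R]_p := (m0 F)^-1 *: base_part F.

Definition beta_brane (F : 'rV[R]_p.+1) : Prop := m0 F != 0.

Definition t_coef (F : 'rV[R]_p.+1) (i : 'I_p) : R :=
  2 * \sum_(j < p) Cmx G i j * (c1B G 0 j / 2 + slope F 0 j).

Definition special_brane (F : 'rV[R]_p.+1) : Prop :=
  beta_brane F /\ forall i : 'I_p, t_coef F i < 0.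

Definition mixed_brane (F : 'rV[R]_p.+1) : Prop :=
  beta_brane F /\ ~ special_brane F.

(* C(b/2 + j/j_0, b + m/m_0) for the Kaehler class J and the flux F. *)
Definition sign_pairing (J F : 'rV[R]_p.+1) : R :=
  Cform G (2^-1 *: c1B G + slope J) (c1B G + slope F).

End Branes.

(* Main.v *)
(* With X = b/2 + m/m_0 for a flux and Y = b/2 + j/j_0 for the Kaehler class, K
   becomes, up to the 0-th coordinates, C(X,Y) + C(Y,Z) + C(X,Z) + C(b,b)/4.
   The supersymmetry equation and inequality then combine to
   3 C(X,Y) + C(b,b)/4 < 0 for every beta-brane, so all stacks contribute with
   the same sign to the D5 tadpoles contracted with Y, and each one separately
   satisfies - m_0^2 C(X,Y) <= 6 C(b,Y).
   - For a special brane each contribution to the tadpole of D_i is a negative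
     multiple of m_0, hence |m_0| \sum_i Y_i <= \sum_i Y_i T_i.
   - If C(Y, b + m/m_0) <= 0 then - C(X,Y) >= C(b,Y)/2 and m_0^2 <= 12.
   - For a mixed brane the Lorentzian signature forces C(X,X) <= 0, and the
     supersymmetry equation gives m_0^2 < 16 once j_0 >= 5. *)
Require Import Defs.
From mathcomp Require Import all_boot all_order all_algebra.
From mathcomp Require Import reals.
From mathcomp Require Import ring lra.

Set Implicit Arguments.
Unset Strict Implicit.
Unset Printing Implicit Defensive.

Import Order.TTheory GRing.Theory Num.Theory.
Local Open Scope ring_scope.

(** * Algebra of the intersection form C and of the triple form K on X *)

Section IntersectionForm.
Variables (R : realType) (p : nat) (G : base_data R p).
Implicit Types u v w : 'rV[R]_p.

Lemma CformE u v : Cform G u v = (u *m Cmx G *m v^T) 0 0.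
Proof.
rewrite mxE /Cform exchange_big; apply: eq_bigr => j _.
by rewrite !mxE mulr_suml.
Qed.

Lemma CformDl u v w : Cform G (u + v) w = Cform G u w + Cform G v w.
Proof. by rewrite !CformE !mulmxDl mxE. Qed.

Lemma CformDr u v w : Cform G u (v + w) = Cform G u v + Cform G u w.
Proof. by rewrite !CformE linearD mulmxDr mxE. Qed.

Lemma CformZl a u w : Cform G (a *: u) w = a * Cform G u w.
Proof. by rewrite !CformE -!scalemxAl mxE. Qed.

Lemma CformZr a u w : Cform G u (a *: w) = a * Cform G u w.
Proof. by rewrite !CformE linearZ /= -!scalemxAr mxE. Qed.

Lemma Cform0l u : Cform G 0 u = 0.
Proof. by rewrite CformE !mul0mx mxE. Qed.

Lemma Cform_deltal i u :
  Cform G (delta_mx 0 i) u = \sum_(j < p) Cmx G i j * u 0 j.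
Proof.
rewrite /Cform (bigD1 i) //= [X in _ + X]big1 ?addr0 => [|k /negPf ik].
  by apply: eq_bigr => j _; rewrite [delta_mx _ _ _ _]mxE !eqxx /= mul1r.
by rewrite big1 // => j _; rewrite [delta_mx _ _ _ _]mxE ik andbF !mul0r.
Qed.

Lemma Cform_delta i j : Cform G (delta_mx 0 i) (delta_mx 0 j) = Cmx G i j.
Proof.
rewrite Cform_deltal (bigD1 j) //= [X in _ + X]big1 ?addr0 => [|k /negPf jk].
  by rewrite [delta_mx _ _ _ _]mxE !eqxx mulr1.
by rewrite [delta_mx _ _ _ _]mxE jk andbF mulr0.
Qed.

Lemma Cform_suml u v :
  Cform G u v = \sum_(i < p) u 0 i * Cform G (delta_mx 0 i) v.
Proof.
apply: eq_bigr => i _; rewrite Cform_deltal mulr_sumr.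
by apply: eq_bigr => j _; rewrite mulrA.
Qed.

Lemma K000E : K000 G = Cform G (c1B G) (c1B G).
Proof. by apply: eq_bigr => i _; apply: eq_bigr => j _; rewrite mulrAC. Qed.

Hypothesis symC : (inter_mx G)^T = inter_mx G.

Lemma CmxC i j : Cmx G i j = Cmx G j i.
Proof. by rewrite !mxE -[in LHS]symC mxE. Qed.

Lemma CformC u v : Cform G u v = Cform G v u.
Proof.
rewrite /Cform exchange_big; apply: eq_bigr => i _; apply: eq_bigr => j _.
by rewrite CmxC; ring.
Qed.

Lemma K00E i : K00 G i = Cform G (delta_mx 0 i) (c1B G).
Proof. by rewrite Cform_deltal; apply: eq_bigr => j _; rewrite mulrC. Qed.

(** Separates the eight patterns of zero and base indices, matching the case split in [Kcoef]. *)
Lemma sum3_recl (F : 'I_p.+1 -> 'I_p.+1 -> 'I_p.+1 -> R) :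
  let h := lift (ord0 : 'I_p.+1) in
  \sum_I \sum_J \sum_L F I J L =
    F ord0 ord0 ord0 + \sum_l F ord0 ord0 (h l) + \sum_j F ord0 (h j) ord0
    + \sum_i F (h i) ord0 ord0 + \sum_j \sum_l F ord0 (h j) (h l)
    + \sum_i \sum_l F (h i) ord0 (h l) + \sum_i \sum_j F (h i) (h j) ord0
    + \sum_i \sum_j \sum_l F (h i) (h j) (h l).
Proof.
move=> h.
have sum2 (H : 'I_p.+1 -> 'I_p.+1 -> R) : \sum_I \sum_J H I J =
    H ord0 ord0 + \sum_j H ord0 (h j) + \sum_i H (h i) ord0
    + \sum_i \sum_j H (h i) (h j).
  rewrite !big_ord_recl -!addrA; congr (_ + (_ + _)).
  by rewrite -big_split; apply: eq_bigr => i _; rewrite big_ord_recl.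
rewrite big_ord_recl sum2.
under [X in _ + X = _]eq_bigr => i _ do rewrite sum2.
rewrite !big_split /=; ring.
Qed.

(** Uses K_{000} = C(b,b) and K_{00i} = C(D_i,b); the pattern with three base indices drops out,
    pullbacks from B having zero triple intersection. *)
Lemma KformE (u v w : 'rV[R]_p.+1) :
  Kform G u v w =
    m0 u * m0 v * m0 w * Cform G (c1B G) (c1B G)
    + m0 u * m0 v * Cform G (base_part w) (c1B G)
    + m0 u * m0 w * Cform G (base_part v) (c1B G)
    + m0 v * m0 w * Cform G (base_part u) (c1B G)
    + m0 u * Cform G (base_part v) (base_part w)
    + m0 v * Cform G (base_part u) (base_part w)
    + m0 w * Cform G (base_part u) (base_part v).
Proof.
have sumK (x : 'rV[R]_p.+1) a : \sum_(i < p) a * K00 G i * x 0 (lift ord0 i) =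
    a * Cform G (base_part x) (c1B G).
  rewrite Cform_suml mulr_sumr; apply: eq_bigr => i _.
  by rewrite -K00E mxE; ring.
have sumC (x y : 'rV[R]_p.+1) a :
    \sum_(i < p) \sum_(j < p)
      a * Cmx G i j * x 0 (lift ord0 i) * y 0 (lift ord0 j) =
    a * Cform G (base_part x) (base_part y).
  rewrite mulr_sumr; apply: eq_bigr => i _; rewrite mulr_sumr.
  by apply: eq_bigr => j _; rewrite !mxE; ring.
rewrite /Kform sum3_recl.
rewrite [X in _ + X]big1 ?addr0; last first.
  move=> i _; rewrite big1 // => j _; rewrite big1 // => l _.
  by rewrite /Kcoef !liftK !mul0r.
have k00 i : Kcoef G (lift ord0 i) ord0 ord0 = K00 G i.
  by rewrite /Kcoef liftK !unlift_none.
have k0i i : Kcoef G ord0 (lift ord0 i) ord0 = K00 G i.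
  by rewrite /Kcoef liftK !unlift_none.
have k1i i : Kcoef G ord0 ord0 (lift ord0 i) = K00 G i.
  by rewrite /Kcoef liftK !unlift_none.
have kij i j : Kcoef G (lift ord0 i) (lift ord0 j) ord0 = Cmx G i j.
  by rewrite /Kcoef !liftK unlift_none.
have ki0j i j : Kcoef G (lift ord0 i) ord0 (lift ord0 j) = Cmx G i j.
  by rewrite /Kcoef !liftK unlift_none.
have k0ij i j : Kcoef G ord0 (lift ord0 i) (lift ord0 j) = Cmx G i j.
  by rewrite /Kcoef !liftK unlift_none.
have -> : Kcoef G ord0 ord0 ord0 = Cform G (c1B G) (c1B G).
  by rewrite /Kcoef unlift_none K000E.
rewrite -!sumK -!sumC /m0.
do ![congr (_ + _)]; first (by ring).
all: try (by apply: eq_bigr => i _; rewrite ?k00 ?k0i ?k1i; ring).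
all: apply: eq_bigr => i _; apply: eq_bigr => j _; rewrite ?kij ?ki0j ?k0ij; ring.
Qed.
End IntersectionForm.

(** * Consequences of the Lorentzian signature *)

Lemma lorentz_coordinates (R : realType) (p : nat) (G : base_data R p.+1) :
  has_signature (Cmx G) 1 p ->
  exists2 Q : 'M[R]_p.+1, Q \in unitmx &
    forall u v, Cform G u v =
      (u *m Q) 0 ord0 * (v *m Q) 0 ord0
      - \sum_(i < p) (u *m Q) 0 (lift ord0 i) * (v *m Q) 0 (lift ord0 i).
Proof.
(* If P diagonalises C by congruence, the diagonal coordinates u' satisfy u = u' P^T, so Q is the
   inverse of P^T. *)
case=> _ [P uP eqD]; exists (invmx P^T) => [|u v].
  by rewrite unitmx_inv unitmx_tr.
have uPT : P^T \in unitmx by rewrite unitmx_tr.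
set u' := u *m _; set v' := v *m _.
have -> : u = u' *m P^T by rewrite /u' mulmxKV.
have -> : v = v' *m P^T by rewrite /v' mulmxKV.
rewrite CformE trmx_mul trmxK -2!mulmxA (mulmxA (Cmx G)).
rewrite (mulmxA P^T) (mulmxA P^T) eqD.
rewrite mulmxA mul_mx_diag mxE big_ord_recl !mxE mulr1 -sumrN.
by congr (_ + _); apply: eq_bigr => i _; rewrite !mxE /= mulrN1 mulNr.
Qed.

(** The orthogonal complement of a time-like vector is negative definite. *)
Lemma timelike_orthogonal (R : realType) (p : nat) (G : base_data R p)
    (v w : 'rV[R]_p) :
  has_signature (Cmx G) 1 p.-1 ->
  0 < Cform G v v -> Cform G v w = 0 -> 0 <= Cform G w w -> w = 0.
Proof.
case: p G v w => [|p] G v w; first by case.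
case/lorentz_coordinates => Q uQ formE.
pose spatial (z : 'rV[R]_p.+1) := \sum_(i < p) ((z *m Q) 0 (lift ord0 i)) ^+ 2.
have spatial_ge0 z : 0 <= spatial z by apply: sumr_ge0 => i _; apply: sqr_ge0.
have sqE z : Cform G z z = ((z *m Q) 0 ord0) ^+ 2 - spatial z.
  by rewrite formE; congr (_ - _); apply: eq_bigr => i _; rewrite expr2.
move=> vv vw ww.
set a := (v *m Q) 0 ord0; set c := (w *m Q) 0 ord0.
have c0 : c = 0.
  (* [a w - c v] has no time component, hence non-positive square. *)
  have wv : Cform G w v = 0.
    rewrite -vw !formE; congr (_ - _); first exact: mulrC.
    by apply: eq_bigr => i _; rewrite mulrC.
  have := sqE (a *: w + (- c) *: v).
  rewrite !(CformDl, CformDr, CformZl, CformZr) vw wv mulmxDl -!scalemxAl.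
  rewrite [X in X ^+ 2]mxE [X in (X + _) ^+ 2]mxE [X in (_ + X) ^+ 2]mxE -/a -/c.
  have := spatial_ge0 (a *: w + - c *: v).
  move: (spatial _) => S S0 E.
  have : c ^+ 2 * Cform G v v <= 0.
    have := mulr_ge0 (sqr_ge0 a) ww; nra.
  by rewrite pmulr_lle0 // => c2; apply/eqP; rewrite -sqrf_eq0 eq_le c2 sqr_ge0.
(* Without time component, C(w,w) is minus a sum of squares, so its nonnegativity kills every
   spatial coordinate. *)
have w0 i : (w *m Q) 0 i = 0.
  have : spatial w == 0.
    rewrite eq_le spatial_ge0 andbT; move: ww.
    by rewrite sqE -/c c0 expr0n /= sub0r oppr_ge0.
  rewrite psumr_eq0 => [/allP z|k _]; last exact: sqr_ge0.
  case: (unliftP ord0 i) => [k|] ->; last exact: c0.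
  by apply/eqP; rewrite -sqrf_eq0; apply: z; rewrite mem_index_enum.
rewrite -[w](mulmxK uQ); have -> : w *m Q = 0 by apply/rowP => i; rewrite w0 mxE.
exact: mul0mx.
Qed.

(** * Positivity on the base *)

Section AdmissibleBase.
Variables (R : realType) (p : nat) (G : base_data R p).
Hypotheses (hp : (0 < p)%N) (hG : admissible_base G).
Let b := c1B G.
Let D (i : 'I_p) : 'rV[R]_p := delta_mx 0 i.
Let symC := inter_mx_sym hG.

(** C(b,b) is the sum of the nonnegative terms b_i K_{00i}; if it vanished, b would be 0,
    contradicting K_{00i} > 0. *)
Lemma c1_sq_gt0 : 0 < Cform G b b.
Proof.
rewrite Cform_suml lt_neqAle eq_sym; apply/andP; split.
  rewrite psumr_eq0 => [|i _]; last first.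
    by rewrite mulr_ge0 ?(c1_ge0 hG) // -K00E // ltW // (K00_gt0 hG).
  apply/negP => /allP b0; have /lt0r_neq0/eqP[] := K00_gt0 hG (Ordinal hp).
  rewrite K00E // CformC // Cform_suml big1 // => i _.
  have /eqP := b0 i (mem_index_enum _); rewrite -K00E // => /eqP.
  by rewrite mulf_eq0 (gt_eqF (K00_gt0 hG i)) orbF => /eqP ->; rewrite mul0r.
by apply: sumr_ge0 => i _; rewrite mulr_ge0 ?(c1_ge0 hG) // -K00E // ltW // (K00_gt0 hG).
Qed.

Lemma basis_sq_ge0 i : 0 <= Cform G (D i) (D i).
Proof. by have [u [_ /(_ i)[]]] := basis_causal hG. Qed.

(** If D_i . D_j < 0, then w = K_{00j} D_i - K_{00i} D_j would be time-like, yet it is orthogonal to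
    the time-like b. *)
Lemma basis_pair_ge0 i j : 0 <= Cform G (D i) (D j).
Proof.
rewrite leNgt; apply/negP => ij.
have ki := K00_gt0 hG i; have kj := K00_gt0 hG j.
pose w := K00 G j *: D i + (- K00 G i) *: D j.
have ww : 0 < Cform G w w.
  rewrite !(CformDl, CformDr, CformZl, CformZr) (CformC symC (D j) (D i)).
  have := basis_sq_ge0 i; have := basis_sq_ge0 j => jj ii.
  have := mulr_ge0 (sqr_ge0 (K00 G j)) ii.
  have := mulr_ge0 (sqr_ge0 (K00 G i)) jj.
  have := mulr_gt0 ki kj; nra.
have bw : Cform G b w = 0.
  by rewrite !(CformDr, CformZr) !(CformC symC b) -!K00E //; ring.
have w0 := timelike_orthogonal (inter_signature hG) c1_sq_gt0 bw (ltW ww).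
by move: ww; rewrite w0 Cform0l ltxx.
Qed.

Lemma effective_pair_ge0 (u v : 'rV[R]_p) :
  (forall i, 0 <= u 0 i) -> (forall i, 0 <= v 0 i) -> 0 <= Cform G u v.
Proof.
move=> u0 v0; apply: sumr_ge0 => i _; apply: sumr_ge0 => j _.
by rewrite -(Cform_delta G) !mulr_ge0 // basis_pair_ge0.
Qed.

(** C(X, .) is negative on Y and nonnegative on D_i, so some nonnegative combination w of the two is
    orthogonal to X. Being effective, w has C(w,w) >= 0; a time-like X would force w = 0, although w
    pairs positively with b. *)
Lemma spacelike_or_null (X Y : 'rV[R]_p) (i : 'I_p) :
  (forall j, 0 <= Y 0 j) -> 0 < Cform G b Y ->
  Cform G X Y < 0 -> 0 <= Cform G (D i) X -> Cform G X X <= 0.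
Proof.
move=> Y0 bY XY DX; rewrite leNgt; apply/negP => XX.
pose w := (- Cform G X Y) *: D i + Cform G (D i) X *: Y.
have Xw : Cform G X w = 0 by rewrite CformDr !CformZr (CformC symC X (D i)); ring.
have D0 j : 0 <= D i 0 j by rewrite mxE ler0n.
have w_ge0 j : 0 <= w 0 j.
  by rewrite /w !mxE addr_ge0 // mulr_ge0 ?ler0n // oppr_ge0 ltW.
have w0 := timelike_orthogonal (inter_signature hG) XX Xw (effective_pair_ge0 w_ge0 w_ge0).
have : Cform G w b = 0 by rewrite w0 Cform0l.
rewrite CformDl !CformZl -K00E // (CformC symC Y).
have := mulr_ge0 DX (ltW bY); have := K00_gt0 hG i; nra.
Qed.

End AdmissibleBase.

(** * Triple intersections and supersymmetry conditions in shifted slopes *)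

Definition half_shift (R : realType) (p : nat) (G : base_data R p)
    (F : 'rV[R]_p.+1) : 'rV[R]_p :=
  2^-1 *: c1B G + slope F.

Section Branes.
Variables (R : realType) (p : nat) (G : base_data R p).
Hypotheses (hp : (0 < p)%N) (hG : admissible_base G).
Let b := c1B G.
Let bb := Cform G b b.
Let D (i : 'I_p) : 'rV[R]_p := delta_mx 0 i.
Let symC := inter_mx_sym hG.
Local Notation sh := (half_shift G).
Implicit Types F J : 'rV[R]_p.+1.

Lemma base_partE F : m0 F != 0 -> base_part F = m0 F *: (sh F - 2^-1 *: b).
Proof.
by move=> F0; rewrite /half_shift addrAC subrr add0r /slope scalerA mulfV ?scale1r.
Qed.

(* Shifting slopes by b/2 removes the terms of K linear in b. *)
Lemma Kform_shift F J L : m0 F != 0 -> m0 J != 0 -> m0 L != 0 ->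
  Kform G F J L = m0 F * m0 J * m0 L *
    (Cform G (sh F) (sh J) + Cform G (sh J) (sh L) + Cform G (sh F) (sh L) + bb / 4).
Proof.
move=> F0 J0 L0; rewrite KformE // !base_partE // -/b.
rewrite -!scaleNr !(CformDl, CformDr, CformZl, CformZr).
rewrite !(CformC symC b) /bb.
by field; rewrite F0 J0 L0.
Qed.

Lemma t_coefE F i : t_coef G F i = 2 * Cform G (D i) (sh F).
Proof.
congr (2 * _); rewrite Cform_deltal; apply: eq_bigr => j _; congr (_ * _).
by rewrite !mxE mulrC.
Qed.

Lemma m0_Dcls i : m0 (Dcls R (lift ord0 i) : 'rV_p.+1) = 0.
Proof. by rewrite /m0 /Dcls mxE. Qed.

Lemma base_part_Dcls i : base_part (Dcls R (lift ord0 i) : 'rV_p.+1) = D i.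
Proof. by apply/rowP => j; rewrite !mxE (inj_eq lift_inj). Qed.

Lemma Kform_base F i : Kform G F F (Dcls R (lift ord0 i)) =
  m0 F * (m0 F * K00 G i + 2 * Cform G (D i) (base_part F)).
Proof.
rewrite KformE // m0_Dcls base_part_Dcls -K00E // (CformC symC _ (D i)); ring.
Qed.

Lemma Kform_base_beta F i : m0 F != 0 ->
  Kform G F F (Dcls R (lift ord0 i)) = m0 F ^+ 2 * (2 * Cform G (D i) (sh F)).
Proof.
move=> F0; rewrite Kform_base base_partE // CformZr !CformDr -scaleNr !CformZr.
by rewrite K00E //; field.
Qed.

(** K(F,F,D_i) is m_0 times an integer, by integrality of the flux and of K_{00i}. It is negative
    for a special brane, so that integer has absolute value at least 1. *)
Lemma Kform_base_special F i : integral_flux G F -> special_brane G F ->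
  Kform G F F (Dcls R (lift ord0 i)) <= - `|m0 F|.
Proof.
case=> _ intm intC [F0 /(_ i)]; rewrite t_coefE => ti.
have : Kform G F F (Dcls R (lift ord0 i)) < 0.
  by rewrite Kform_base_beta // pmulr_rlt0 // exprn_even_gt0.
rewrite Kform_base.
have /intrP[z ->] : m0 F * K00 G i + 2 * Cform G (D i) (base_part F) \is a Num.int.
  rewrite rpredD // rpredM // ?(K00_int hG) //; last by rewrite Cform_deltal.
  exact: (rpred_nat _ 2).
move=> K0; have z1 : 1 <= `|z%:~R : R|.
  rewrite -intr_norm ler1z -gtz0_ge1 normr_gt0; apply: contraTneq K0 => ->.
  by rewrite mulr0 ltxx.
have := ltr0_norm K0; rewrite normrM => E.
have := ler_peMr (normr_ge0 (m0 F)) z1; lra.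
Qed.

Lemma susy_shift F J : m0 F != 0 -> 0 < m0 J ->
  3 * Kform G J J F = Kform G F F F ->
  3 * m0 J ^+ 2 * (2 * Cform G (sh F) (sh J) + Cform G (sh J) (sh J) + bb / 4) =
  m0 F ^+ 2 * (3 * Cform G (sh F) (sh F) + bb / 4).
Proof.
move=> F0 J0; have J0' := lt0r_neq0 J0.
rewrite !Kform_shift // (CformC symC (sh J) (sh F)) => E.
apply: (mulfI F0); move: E.
by move: (Cform _ _ _) (Cform _ _ _) (Cform _ _ _) (bb / 4) => x y z e E; lra.
Qed.

(** Eliminating C(Y,Y) from the inequality by [susy_shift] also cancels C(X,X), and leaves (j_0^2 +
    m_0^2) (3 C(X,Y) + C(b,b)/4) < 0. *)
Lemma beta_pairing_lt0 F J : m0 F != 0 -> 0 < m0 J ->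
  3 * Kform G J J F = Kform G F F F -> 3 * Kform G J F F < Kform G J J J ->
  3 * Cform G (sh F) (sh J) + bb / 4 < 0.
Proof.
move=> F0 J0 /(susy_shift F0 J0); have J0' := lt0r_neq0 J0.
rewrite !Kform_shift // (CformC symC (sh J) (sh F)).
move: J0; move: (Cform G (sh F) (sh F)) (Cform G (sh J) (sh J)) (Cform G (sh F) (sh J)).
move: (bb / 4) (m0 F) (m0 J) => e m j a c s J0 E I.
have {}I : 3 * m ^+ 2 * (a + 2 * s + e) < j ^+ 2 * (3 * c + e).
  by rewrite -(ltr_pM2l J0); lra.
have : (j ^+ 2 + m ^+ 2) * (3 * s + e) < 0 by lra.
by rewrite pmulr_rlt0 // ltr_pwDl ?sqr_ge0 // exprn_gt0.
Qed.

Lemma kahler_shift_gt0 J i : (forall I, 0 < J 0 I) -> 0 < sh J 0 i.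
Proof.
move=> J0; rewrite !mxE ltr_wpDl //.
  by rewrite mulr_ge0 ?invr_ge0 ?(c1_ge0 hG).
by rewrite mulr_gt0 // invr_gt0; apply: J0.
Qed.

Lemma c1_kahler_gt0 J : (forall I, 0 < J 0 I) -> 0 < Cform G b (sh J).
Proof.
move=> J0; rewrite CformC // Cform_suml (bigD1 (Ordinal hp)) //= ltr_pwDl //.
  by rewrite mulr_gt0 ?kahler_shift_gt0 // -K00E // (K00_gt0 hG).
by apply: sumr_ge0 => i _; rewrite ltW // mulr_gt0 ?kahler_shift_gt0 // -K00E // (K00_gt0 hG).
Qed.

(** The difference of the two sides is C(j/j_0, j/j_0), nonnegative because j/j_0 is effective. *)
Lemma c1_kahler_le J : (forall I, 0 < J 0 I) ->
  Cform G b (sh J) <= Cform G (sh J) (sh J) + bb / 4.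
Proof.
move=> J0; have y0 i : 0 <= slope J 0 i by rewrite !mxE mulr_ge0 ?invr_ge0 // ltW //; apply: J0.
have := effective_pair_ge0 hp hG y0 y0.
rewrite /half_shift !(CformDl, CformDr, CformZl, CformZr) -/b (CformC symC _ b).
by rewrite /bb; lra.
Qed.

End Branes.

(** * Arithmetic behind the bound 3 *)

Lemma int_norm_lt4 (R : realType) (x : R) :
  x \is a Num.int -> x ^+ 2 < 16 -> `|x| <= 3.
Proof.
case/intrP => z -> zz; rewrite -intr_norm.
have : (`|z|%:~R : R) < 4%:~R.
  rewrite -(@ltr_pXn2r _ 2) ?nnegrE ?ler0z //.
  by rewrite intr_norm real_normK ?num_real //; apply: lt_le_trans zz _; lra.
by rewrite ltr_int => z4; rewrite -[leRHS]/(3%:~R) ler_int -ltzD1.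
Qed.

(** Read x, s, c as C(X,X), C(X,Y), C(Y,Y), with e = C(b,b)/4 and B = C(b,Y). If m^2 >= 16, the
    equation and the load bound give 3 j^2 B (m^2 - 12) <= m^4 e, while m^2 e <= -3 m^2 s <= 18
    B. *)
Lemma mixed_arith (R : realFieldType) (m j x s c e B : R) :
  5 <= j -> 0 < e -> 0 < B -> B <= c + e -> x <= 0 -> 3 * s + e < 0 ->
  - (m ^+ 2 * s) <= 6 * B ->
  3 * j ^+ 2 * (2 * s + c + e) = m ^+ 2 * (3 * x + e) ->
  m ^+ 2 < 16.
Proof.
move=> j5 e0 B0 cB x0 se bound E; rewrite ltNge; apply/negP => m16.
have m2 : 0 < m ^+ 2 by lra.
have j25 : 25 <= j ^+ 2 by nra.
have e1 : 3 * j ^+ 2 * (2 * s + B) <= m ^+ 2 * e.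
  apply: (@le_trans _ _ (3 * j ^+ 2 * (2 * s + c + e))).
    by rewrite ler_pM2l; lra.
  by rewrite E ler_pM2l //; lra.
have e2 : 3 * j ^+ 2 * (B * (m ^+ 2 - 12)) <= m ^+ 2 * (m ^+ 2 * e).
  apply: (@le_trans _ _ (m ^+ 2 * (3 * j ^+ 2 * (2 * s + B)))).
    by rewrite [leRHS]mulrCA ler_pM2l; lra.
  by rewrite ler_pM2l.
have e3 : m ^+ 2 * e <= 18 * B.
  have : m ^+ 2 * (3 * s + e) < 0 by rewrite pmulr_rlt0.
  lra.
have : 3 * j ^+ 2 * (m ^+ 2 - 12) <= 18 * m ^+ 2.
  rewrite -(ler_pM2l B0).
  by have := ler_wpM2l (ltW m2) e3; lra.
(* With j^2 >= 25 this yields 57 m^2 <= 900, whereas m^2 >= 16 gives 57 m^2 >= 912. *)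
have : 3 * 25 * (m ^+ 2 - 12) <= 3 * j ^+ 2 * (m ^+ 2 - 12).
  by rewrite ler_pM2r; lra.
lra.
Qed.

(** * Tadpole bounds in a supersymmetric configuration *)

Section Configurations.
Variables (R : realType) (p : nat) (G : base_data R p).
Variable cfg : configuration R p.
Hypotheses (hp : (0 < p)%N) (hG : admissible_base G).
Hypothesis susy : supersymmetric G cfg.
Let b := c1B G.
Let J := kahler cfg.
Let Y := half_shift G J.
Let symC := inter_mx_sym hG.
Implicit Types a : 'I_(stacks cfg).

Let J0 : forall I, 0 < J 0 I := kahler_gt0 susy.

Lemma beta_lt0 a : beta_brane (flux a) ->
  3 * Cform G (half_shift G (flux a)) Y + Cform G b b / 4 < 0.
Proof.
move=> F0; rewrite /Y /J.
exact (beta_pairing_lt0 hG F0 (J0 ord0) (susy_eq susy a) (susy_ineq susy a)).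
Qed.

(** Contribution of a single brane of the stack to the D5 tadpoles contracted with Y; the
    multiplicity N^a is left out. *)
Let load a := \sum_(i < p) Y 0 i * Kform G (flux a) (flux a) (Dcls R (lift ord0 i)).

Lemma loadE a : beta_brane (flux a) ->
  load a = 2 * m0 (flux a) ^+ 2 * Cform G (half_shift G (flux a)) Y.
Proof.
move=> F0; rewrite (CformC symC _ Y) Cform_suml mulr_sumr.
by apply: eq_bigr => i _; rewrite Kform_base_beta //; ring.
Qed.

Lemma load_le0 a : load a <= 0.
Proof.
have [F0|F0] := eqVneq (m0 (flux a)) 0.
  by rewrite /load big1 // => i _; rewrite Kform_base // F0 mul0r mulr0.
have m2 : 0 < 2 * m0 (flux a) ^+ 2 by rewrite mulr_gt0 // exprn_even_gt0.
rewrite loadE // pmulr_rle0 //.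
have := beta_lt0 F0; have := c1_sq_gt0 hp hG; rewrite -/b; lra.
Qed.

(** Since n^{D5} >= 0 and Y_i > 0, the total load is at least the left side. No load is positive and
    N^a >= 1, so each single load is at least the total. *)
Lemma load_ge a : - \sum_(i < p) Y 0 i * tadpole_base G i <= load a.
Proof.
have Y0 i : 0 <= Y 0 i by rewrite ltW // kahler_shift_gt0.
apply: (@le_trans _ _ (\sum_(c < stacks cfg) (nbranes c)%:R * load c)).
  rewrite /load; under [leRHS]eq_bigr => c _ do rewrite mulr_sumr.
  rewrite [leRHS]exchange_big -sumrN; apply: ler_sum => i _ /=.
  have /esym := D5_tadpole susy (lift ord0 i); rewrite /tadpole liftK => E.
  have -> : \sum_(c < stacks cfg) (nbranes c)%:R * (Y 0 i *
      Kform G (flux c) (flux c) (Dcls R (lift ord0 i))) =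
      Y 0 i * ((nD5 cfg (lift ord0 i))%:R - tadpole_base G i).
    by rewrite -E mulr_sumr; apply: eq_bigr => c _; rewrite mulrCA.
  by rewrite mulrBr lerBrDl subrr mulr_ge0.
rewrite (bigD1 a) //= -[leRHS]addr0 lerD //.
  by rewrite ler_neMl ?load_le0 // ler1n (nbranes_gt0 susy).
by apply: sumr_le0 => c _; rewrite mulr_ge0_le0 // load_le0.
Qed.

Lemma beta_load_bound a : beta_brane (flux a) ->
  - (m0 (flux a) ^+ 2 * Cform G (half_shift G (flux a)) Y) <= 6 * Cform G b Y.
Proof.
move=> F0; have := load_ge a; rewrite loadE //.
have -> : \sum_(i < p) Y 0 i * tadpole_base G i = 12 * Cform G b Y.
  rewrite (CformC symC b) Cform_suml mulr_sumr; apply: eq_bigr => i _.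
  by rewrite /tadpole_base K00E //; ring.
lra.
Qed.

Lemma tadpole_le_max i : tadpole_base G i <= max_tadpole G.
Proof. exact: le_bigmax. Qed.

Lemma special_bound a : special_brane G (flux a) ->
  `|m0 (flux a)| <= max_tadpole G.
Proof.
move=> special; have Y0 i : 0 < Y 0 i by apply: kahler_shift_gt0.
have S0 : 0 < \sum_(i < p) Y 0 i.
  rewrite (bigD1 (Ordinal hp)) //= ltr_pwDl //.
  by apply: sumr_ge0 => i _; apply: ltW.
rewrite -(ler_pM2r S0).
apply: (@le_trans _ _ (- load a)).
  rewrite lerNr /load mulr_sumr -sumrN; apply: ler_sum => i _.
  rewrite -mulNr [leRHS]mulrC ler_pM2l //.
  exact: Kform_base_special (flux_integral susy a) special.
rewrite lerNl; apply: le_trans (load_ge a).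
rewrite lerN2 mulr_sumr; apply: ler_sum => i _.
by rewrite mulrC ler_pM2r // tadpole_le_max.
Qed.

Lemma nonpos_pairing_bound a : beta_brane (flux a) ->
  sign_pairing G J (flux a) <= 0 -> `|m0 (flux a)| <= 3.
Proof.
move=> F0 pair; apply: int_norm_lt4; first by case: (flux_integral susy a).
have := beta_load_bound F0; have := c1_kahler_gt0 hp hG J0; rewrite -/Y -/b => B0.
set m := m0 _; set s := Cform _ _ _ => bound.
have {}pair : s <= - (Cform G b Y / 2).
  move: pair; rewrite /sign_pairing -/(half_shift G J) -/Y.
  (* As b + m/m_0 = X + b/2, the sign pairing equals C(X,Y) + C(b,Y)/2. *)
  have -> : c1B G + slope (flux a) =
      half_shift G (flux a) + 2^-1 *: b.
    by rewrite /half_shift addrAC -scalerDl [2^-1 + _](_ : _ = 1) ?scale1r //; field.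
  by rewrite CformDr CformZr !(CformC symC Y) -/s; lra.
have : m ^+ 2 * (Cform G b Y / 2) <= 6 * Cform G b Y.
  have := ler_wpM2l (sqr_ge0 m) pair; lra.
move=> bd; have : m ^+ 2 <= 12 by rewrite -(ler_pM2r B0); lra.
lra.
Qed.

Lemma mixed_bound a : 5 <= m0 J -> mixed_brane G (flux a) ->
  `|m0 (flux a)| <= 3.
Proof.
move=> J5 [F0 nspecial]; apply: int_norm_lt4; first by case: (flux_integral susy a).
have [i Di] : exists i, 0 <= t_coef G (flux a) i.
  case: (boolP [forall i, t_coef G (flux a) i < 0]) => [/forallP lt0|].
    by case: nspecial.
  by rewrite negb_forall => /existsP[i]; rewrite -leNgt => ?; exists i.
have {}Di : 0 <= Cform G (delta_mx 0 i) (half_shift G (flux a)).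
  by move: Di; rewrite t_coefE pmulr_rge0.
have B0 := c1_kahler_gt0 hp hG J0; have cB := c1_kahler_le hp hG J0.
have e0 := c1_sq_gt0 hp hG.
have se := beta_lt0 F0; have bound := beta_load_bound F0.
have := susy_shift hG F0 (J0 ord0) (susy_eq susy a).
have : Cform G (half_shift G (flux a)) (half_shift G (flux a)) <= 0.
  apply: (spacelike_or_null hp hG (Y := Y) _ B0 _ Di).
    by move=> j; rewrite ltW // kahler_shift_gt0.
  by move: se; rewrite -/b in e0 *; lra.
move=> x0 E; apply: (mixed_arith J5 _ B0 cB x0 se bound E).
by rewrite divr_gt0.
Qed.

End Configurations.

Theorem mainTheorem2 (R : realType) (p : nat) (hp : (2 <= p)%N)
    (G : base_data R p) (hG : admissible_base G) :
  exists jstar : R,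
    forall cfg : configuration R p,
      supersymmetric G cfg ->
      (forall I : 'I_p.+1, jstar <= kahler cfg 0 I) ->
      forall beta : 'I_(stacks cfg),
        [/\ beta_brane (flux beta) -> `|m0 (flux beta)| <= max_tadpole G,
            special_brane G (flux beta) ->
              0 <= sign_pairing G (kahler cfg) (flux beta) ->
              `|m0 (flux beta)| <= max_tadpole G,
            special_brane G (flux beta) ->
              sign_pairing G (kahler cfg) (flux beta) <= 0 ->
              `|m0 (flux beta)| <= 3 &
            mixed_brane G (flux beta) -> `|m0 (flux beta)| <= 3].
Proof.
have p0 : (0 < p)%N := ltnW hp.
(* The threshold 5 is the lower bound on j_0 required by [mixed_bound]. *)
exists 5 => cfg susy large a; have J5 := large ord0.
(* K_{00i} is a positive integer, so T_i >= 12 and the bound 3 for mixed branes is absorbed in the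
   maximum. *)
have max3 : 3 <= max_tadpole G.
  apply: le_trans (tadpole_le_max G (Ordinal p0)).
  have := K00_gt0 hG (Ordinal p0); rewrite /tadpole_base.
  have /intrP[z ->] := K00_int hG (Ordinal p0).
  by rewrite ltr0z gtz0_ge1 -(ler_int R) => z1; lra.
have mixed := mixed_bound p0 hG susy J5.
split=> [F0|special _|[F0 _]|]; last exact: mixed.
- case: (boolP [forall i, t_coef G (flux a) i < 0]) => [/forallP lt0|].
    exact: special_bound.
  move=> /forallP nspecial; apply: le_trans (mixed _ _) max3.
  by split=> // -[_ lt0]; apply: nspecial.
- exact: special_bound special.
- exact: nonpos_pairing_bound.
Qed.
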